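(* Let $\ell>0$ and $\tau\in\mathbb H$. The period domain $\mathcal P\subset(\mathbb R\times\mathbb C)^4$ is the complement of the collection of codimension-three planes $$\bigcup_{k\in\mathbb Z}\Big(\mathcal H_k\ \cup\ \bigcup_{i_0}\mathcal H_{k,i_0}\ \cup\ \bigcup_{i_0}\mathcal H'_{k,i_0}\ \cup\ \bigcup_{i_1\ne i_2}\mathcal H_{k,i_1,i_2}\Big),$$ where for $i_0\in\{1,\dots,4\}$ and $i_1\neq i_2\in\{1,\dots,4\}$: (1) $\mathcal H_k=\{\sum_{i=1}^4x_i=(2k+1)\ell^2\,\mathrm{Im}\,\tau,\ \sum_{i=1}^4z_i=0\}$; (2) $\mathcal H_{k,i_0}=\{x_{i_0}=k\ell^2\,\mathrm{Im}\,\tau,\ z_{i_0}=0\}$ and $\mathcal H'_{k,i_0}=\{2x_{i_0}-\sum_{i=1}^4x_i=(2k+1)\ell^2\,\mathrm{Im}\,\tau,\ 2z_{i_0}-\sum_{i=1}^4z_i=0\}$; (3) $\mathcal H_{k,i_1,i_2}=\{2(x_{i_1}+x_{i_2})-\sum_{i=1}^4x_i=(2k+1)\ell^2\,\mathrm{Im}\,\tau,\ 2(z_{i_1}+z_{i_2})-\sum_{i=1}^4z_i=0\}$.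
   Context: Coordinates on $(\mathbb R\times\mathbb C)^4$ are $(x_j,z_j)_{j=1}^4$. Let $X$ be an ALG-$D_4$ gravitational instanton with torus parameter $\tau$ and length scale $\ell$, and $(S_0,\dots,S_4)$ a basis of $H_2(X,\mathbb Z)\cong\mathbb Z^5$ with $S_i\cdot S_i=-2$ for all $i$, $S_0\cdot S_i=1$ for $i\ge1$, $S_i\cdot S_j=0$ for $1\le i<j\le4$. The period domain is $$\mathcal P=(\mathbb R\times\mathbb C)^4\setminus\bigcup\Big\{(x_j,z_j)_{j=1}^4:\ \sum_{i=1}^4(\lambda_0-2\lambda_i)(x_i,z_i)=\lambda_0(\ell^2\,\mathrm{Im}\,\tau,0)\Big\},$$ where the union is over integers $\lambda_0,\dots,\lambda_4$ for which $\lambda_0S_0+\sum_{i=1}^4\lambda_iS_i$ has self-intersection $-2$. *)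

(* Defs.v *)
From HB Require Import structures.
From mathcomp Require Import all_boot all_order all_algebra.
From mathcomp Require Import sesquilinear classical_sets reals.
From mathcomp Require Import complex.

Set Implicit Arguments.
Unset Strict Implicit.
Unset Printing Implicit Defensive.

Import Order.TTheory GRing.Theory Num.Theory.

Local Open Scope ring_scope.
Local Open Scope complex_scope.
Local Open Scope classical_set_scope.

(* [Rcomplex R] is the alias of [R[i]] that carries the structure of a left
   module over [R]; here it becomes a real vector space of dimension 2. *)
Fact Rcomplex_vect_iso (R : rcfType) : Vector.axiom 2 (Rcomplex R).
Proof.
exists (fun z : Rcomplex R => \row_(j < 2) if j == ord0 then complex.Re z else complex.Im z).
  move=> a [x y] [x' y']; apply/rowP=> j; rewrite !mxE /=.
  by case: ifP.
exists (fun v : 'rV[R]_2 => v 0 ord0 +i* v 0 ord_max : Rcomplex R).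
  by case=> x y; rewrite !mxE.
move=> v; apply/rowP=> j; rewrite !mxE.
by case: ifP => [/eqP->|] //= nj; congr (v _ _); apply/val_inj; case: j nj => [[|[]]].
Qed.

HB.instance Definition _ (R : rcfType) :=
  Lmodule_hasFinDim.Build R (Rcomplex R) (@Rcomplex_vect_iso R).

(* (R x C)^4 as a real vector space; the coordinates 1, ..., 4 of the
   mathematical notation are the elements of ['I_4]. *)
Notation RxC R := (R^o * Rcomplex R)%type.
Notation RxC4 R := {ffun 'I_4 -> RxC R}.

(* [A] is an affine subspace of [V] of codimension [d]. *)
Definition affine_plane_of_codim (K : fieldType) (V : vectType K) (d : nat)
    (A : set V) : Prop :=
  exists (p : V) (W : {vspace V}),
    (\dim W + d = \dim {:V})%N /\ A = [set v | v - p \in W].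

Section Lattice.

(* The instanton X enters the period domain only through its intersection
   lattice: [H] is H_2(X, Z), [dot] the intersection form, [S] the basis
   (S_0, ..., S_4), and [Zcomb S lam] the class with coordinates [lam]. *)

Variables (H : lmodType int) (dot : {symmetric H}) (S : 'I_5 -> H).

Definition Zcomb (lam : 'I_5 -> int) : H := \sum_(i < 5) lam i *: S i.

Definition is_Zbasis : Prop :=
  forall h : H, exists! lam : {ffun 'I_5 -> int}, h = Zcomb lam.

(* The index 0 is [ord0], and the index i of 1, ..., 4 is [lift ord0 i] with
   [i : 'I_4]. *)
Definition D4_homology_basis : Prop :=
  [/\ is_Zbasis,
      forall i : 'I_5, dot (S i) (S i) = - 2,
      forall i : 'I_4, dot (S ord0) (S (lift ord0 i)) = 1 &
      forall i j : 'I_4, (i < j)%N ->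
        dot (S (lift ord0 i)) (S (lift ord0 j)) = 0].

Variables (R : realType) (ell : R) (tau : R[i]).

Definition period_wall (lam : 'I_5 -> int) : set (RxC4 R) :=
  [set p | \sum_(i < 4) p i *~ (lam ord0 - 2 * lam (lift ord0 i)) =
           ((ell ^+ 2 * complex.Im tau, 0) : RxC R) *~ lam ord0].

Definition period_domain : set (RxC4 R) :=
  ~` \bigcup_(lam in [set lam | dot (Zcomb lam) (Zcomb lam) = - 2])
       period_wall lam.

End Lattice.

Section Planes.

Variables (R : realType) (ell : R) (tau : R[i]).

Definition xc (p : RxC4 R) (i : 'I_4) : R := (p i).1.
Definition zc (p : RxC4 R) (i : 'I_4) : R[i] := (p i).2.

Definition plane (k : int) : set (RxC4 R) :=
  [set p | \sum_(i < 4) xc p i = (2 * k + 1)%:~R * ell ^+ 2 * complex.Im tau /\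
           \sum_(i < 4) zc p i = 0].

Definition plane1 (k : int) (i0 : 'I_4) : set (RxC4 R) :=
  [set p | xc p i0 = k%:~R * ell ^+ 2 * complex.Im tau /\ zc p i0 = 0].

Definition plane1' (k : int) (i0 : 'I_4) : set (RxC4 R) :=
  [set p | 2 * xc p i0 - \sum_(i < 4) xc p i
             = (2 * k + 1)%:~R * ell ^+ 2 * complex.Im tau /\
           2 * zc p i0 - \sum_(i < 4) zc p i = 0].

Definition plane2 (k : int) (i1 i2 : 'I_4) : set (RxC4 R) :=
  [set p | 2 * (xc p i1 + xc p i2) - \sum_(i < 4) xc p i
             = (2 * k + 1)%:~R * ell ^+ 2 * complex.Im tau /\
           2 * (zc p i1 + zc p i2) - \sum_(i < 4) zc p i = 0].

End Planes.

(* Main.v *)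
Require Import Defs.
From HB Require Import structures.
From mathcomp Require Import all_boot all_order all_algebra.
From mathcomp Require Import sesquilinear boolp classical_sets reals.
From mathcomp Require Import complex zify ring lra.
Import Order.TTheory GRing.Theory Num.Theory.
Local Open Scope ring_scope.
Local Open Scope complex_scope.
Local Open Scope classical_set_scope.

(** Write [n] for lambda_0, [a_i] for lambda_i and [c_i = n - 2 a_i] for the
    coefficients of a wall.  The intersection form of the affine D4 lattice
    satisfies [sum_i c_i^2 = - 2 q(lambda)] ([D4_norm]), since it is semidefinite
    and becomes a sum of four squares in the coordinates [c_i].  So the classes
    of square -2 are exactly the integer vectors [(c, n)] with
    [c_i = n mod 2] and [sum_i c_i^2 = 4].

    A sum of four squares of equal parity is 4 in two ways only.  If [n] is
    even, half of [c] is plus or minus a unit vector ([sum_sqr_eq1]).  If [n] is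
    odd, every [c_i] is 1 or -1, and up to a global sign at most two of them are
    1 ([signs4]): all signs equal, one sign different, or two against two.
    Scaling [(c, n)] by a nonzero integer does not change the wall
    ([wall_scale]); this absorbs the sign and, for even [n], the factor 2, and
    leaves the four families of planes ([planes_of_root]).  In the other
    direction, the equation of each plane, multiplied by 1 or 2, is the wall of
    an explicit class ([period_wall_of_root]).

    Each wall is a fibre of [p |-> sum_i c_i p_i], which maps (R x C)^4 onto the
    three-dimensional space R x C as soon as some [c_i] is nonzero; hence the
    codimension ([wall_codim]). *)

(** * Fibres of surjective linear maps *)

Lemma linear_fiber_codim (K : fieldType) (V W : vectType K) (f : 'Hom(V, W))
    (b : W) :
  limg f = fullv -> affine_plane_of_codim (\dim {:W}) [set v | f v = b].
Proof.
move=> fT.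
have /memv_imgP[p _ bE] : b \in limg f by rewrite fT memvf.
exists p, (lker f); split.
  by rewrite -(limg_ker_dim f fullv) capfv fT.
apply/seteqP; split=> v /=; rewrite memv_ker linearB /= -bE subr_eq0.
  by move=> ->.
by move/eqP.
Qed.

(** * The intersection form as a sum of four squares *)

(** Completing squares: with [n] and [a_i] the coordinates of the class, both
    sides are [4 n^2 - 4 n (sum_i a_i) + 4 (sum_i a_i^2)].  Only the four
    coefficients of the wall appear on the left, so that a bound on the norm
    bounds them although the form is degenerate. *)
Lemma D4_norm (H : lmodType int) (dot : {symmetric H}) (S : 'I_5 -> H)
    (lam : 'I_5 -> int) : D4_homology_basis dot S ->
  \sum_(i < 4) (lam ord0 - 2 * lam (lift ord0 i)) ^+ 2 =
  - 2 * dot (Zcomb S lam) (Zcomb S lam).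
Proof.
case=> _ dotSS dotS0 dotSne.
set n := lam ord0; set a := fun i => lam (lift ord0 i).
pose s := \sum_(i < 4) a i *: S (lift ord0 i).
have dotC u v : dot u v = dot v u by rewrite hermC expr0 mul1r.
have dot0s : dot (S ord0) s = \sum_(i < 4) a i.
  rewrite linear_sumr; apply: eq_bigr => i _.
  by rewrite linearZr_LR /= dotS0 mulr1.
have dotss : dot s s = \sum_(i < 4) - 2 * a i ^+ 2.
  rewrite linear_sumr; apply: eq_bigr => i _.
  rewrite linearZr_LR /= linear_sumlz (bigD1 i) //= big1 => [|j ji].
    by rewrite linearZl_LR /= dotSS; ring.
  rewrite linearZl_LR /=.
  have [ij|ij|/val_inj ij] := ltngtP i j; last by rewrite ij eqxx in ji.
    by rewrite dotC dotSne // mulr0.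
  by rewrite dotSne // mulr0.
have -> : Zcomb S lam = n *: S ord0 + s by rewrite /Zcomb big_ord_recl.
rewrite linearDl !linearDr !linearZl_LR !linearZr_LR /= dotSS (dotC s) dot0s.
rewrite dotss !big_ord_recr !big_ord0 /=; ring.
Qed.

(** * Walls with arbitrary integer coefficients *)

(** The coefficient vectors of [plane1'] and [plane2] are twice a sum of these
    minus the all-ones vector: 1 at the distinguished indices, -1 elsewhere. *)
Definition ind (i0 i : 'I_4) : int := (i == i0)%:R.

Lemma ind_sum (V : zmodType) (f : 'I_4 -> V) i0 :
  \sum_(i < 4) f i *~ ind i0 i = f i0.
Proof.
by rewrite (bigD1 i0) //= big1 /ind ?eqxx ?addr0 // => i /negPf ->.
Qed.

Lemma ind1_sum (V : pzRingType) (f : 'I_4 -> V) i0 :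
  \sum_(i < 4) f i *~ (2 * ind i0 i - 1) = 2 * f i0 - \sum_(i < 4) f i.
Proof.
rewrite -[in RHS](ind_sum _ f i0) mulr_sumr -sumrB; apply: eq_bigr => i _.
by rewrite -!(mulrzl (f i)) intrB intrM mulrBl mul1r mulrA.
Qed.

Lemma ind2_sum (V : pzRingType) (f : 'I_4 -> V) i1 i2 :
  \sum_(i < 4) f i *~ (2 * (ind i1 i + ind i2 i) - 1) =
  2 * (f i1 + f i2) - \sum_(i < 4) f i.
Proof.
rewrite -[in RHS](ind_sum _ f i1) -[in RHS](ind_sum _ f i2) -big_split mulr_sumr.
rewrite -sumrB; apply: eq_bigr => i _.
rewrite -!(mulrzl (f _)).
by rewrite /= -mulrDl intrB intrM -intrD mulrBl mul1r mulrA.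
Qed.

Section Walls.
Variables (R : realType) (ell : R) (tau : R[i]).
Implicit Types (c : 'I_4 -> int) (n d k : int) (p : RxC4 R).

(** A [period_wall] whose coefficients and right-hand side are independent, so
    that its equation can be divided by a common factor; parity is lost in such
    a division, for instance for [plane1]. *)
Definition wall c n : set (RxC4 R) :=
  [set p | \sum_(i < 4) p i *~ c i =
           ((ell ^+ 2 * complex.Im tau, 0) : RxC R) *~ n].

Lemma wallP c n p : wall c n p <->
  \sum_(i < 4) xc p i *~ c i = (ell ^+ 2 * complex.Im tau) *~ n /\
  \sum_(i < 4) zc p i *~ c i = 0.
Proof.
have fstE : (\sum_(i < 4) p i *~ c i).1 = \sum_(i < 4) xc p i *~ c i.
  by rewrite (raddf_sum fst); apply: eq_bigr => i _; rewrite raddfMz.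
have sndE : (\sum_(i < 4) p i *~ c i).2 = \sum_(i < 4) zc p i *~ c i.
  by rewrite (raddf_sum snd); apply: eq_bigr => i _; rewrite raddfMz.
split=> [pW|[xE zE]].
  by rewrite -fstE -sndE pW (raddfMz fst) (raddfMz snd) mul0rz.
by rewrite /wall /= [LHS]surjective_pairing [RHS]surjective_pairing fstE sndE
  xE zE (raddfMz fst) (raddfMz snd) mul0rz.
Qed.

Lemma wall_scale d c n : d != 0 -> wall (fun i => d * c i) (d * n) = wall c n.
Proof.
move=> d0.
have scaleI : injective (fun v : RxC R => v *~ d).
  move=> u v /=; rewrite -!scaler_int; apply: scalerI.
  by rewrite intr_eq0.
have sumE p : \sum_(i < 4) p i *~ (d * c i) = (\sum_(i < 4) p i *~ c i) *~ d.
  by rewrite mulrz_suml; apply: eq_bigr => i _; rewrite -mulrzA mulrC.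
apply/seteqP; split=> p; rewrite /wall /= sumE (mulrC d) mulrzA.
  exact: scaleI.
by move=> ->.
Qed.

(** If [c i0] is nonzero, the coordinate [p i0] alone can be solved for, so the
    linear form is onto R x C. *)
Lemma wall_codim c n i0 : c i0 != 0 -> affine_plane_of_codim 3 (wall c n).
Proof.
move=> ci0.
pose f := fun p : RxC4 R => \sum_(i < 4) p i *~ c i.
have flin : linear f.
  move=> a u v; rewrite /f scaler_sumr -big_split; apply: eq_bigr => i _ /=.
  by rewrite !ffunE mulrzDl scalerMzr.
pose fL := GRing.isLinear.Build _ _ _ _ f flin.
pose g : {linear RxC4 R -> RxC R} := HB.pack f fL.
have gE v : linfun g v = f v by exact: lfunE.
have -> : wall c n = [set v | linfun g v = ((ell ^+ 2 * complex.Im tau, 0) : RxC R) *~ n].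
  by apply/seteqP; split=> p; rewrite /wall /= gE.
have dim3 : \dim {:RxC R} = 3%N by rewrite dimvf.
have := linear_fiber_codim _ _ _ (linfun g); rewrite dim3; apply.
apply/vspaceP => w; rewrite memvf; apply/memv_imgP.
exists [ffun i => if i == i0 then (c i0)%:~R^-1 *: w else 0]; first exact: memvf.
rewrite gE /f (bigD1 i0) //= big1 => [|i /negPf ii0].
  by rewrite !ffunE eqxx addr0 -scaler_int scalerA divff ?scale1r ?intr_eq0.
by rewrite !ffunE ii0 mul0rz.
Qed.

Lemma wall_equations c n (X : RxC4 R -> R) (Z : RxC4 R -> R[i]) :
    (forall p, \sum_(i < 4) xc p i *~ c i = X p) ->
    (forall p, \sum_(i < 4) zc p i *~ c i = Z p) ->
  wall c n = [set p | X p = n%:~R * ell ^+ 2 * complex.Im tau /\ Z p = 0].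
Proof.
move=> XE ZE; rewrite -mulrA mulrzl.
by apply/seteqP; split=> p; [move/wallP|move=> ?; apply/wallP]; rewrite XE ZE.
Qed.

Lemma planeE k : plane ell tau k = wall (fun=> 1) (2 * k + 1).
Proof. by apply/esym/wall_equations => p; apply: eq_bigr. Qed.

Lemma plane1E k i0 : plane1 ell tau k i0 = wall (ind i0) k.
Proof. by apply/esym/wall_equations => p; rewrite ind_sum. Qed.

Lemma plane1'E k i0 :
  plane1' ell tau k i0 = wall (fun i => 2 * ind i0 i - 1) (2 * k + 1).
Proof. by apply/esym/wall_equations => p; rewrite ind1_sum. Qed.

Lemma plane2E k i1 i2 :
  plane2 ell tau k i1 i2 =
  wall (fun i => 2 * (ind i1 i + ind i2 i) - 1) (2 * k + 1).
Proof. by apply/esym/wall_equations => p; rewrite ind2_sum. Qed.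

End Walls.

Arguments wall {R} ell tau c n.

Lemma period_wallE (R : realType) (ell : R) (tau : R[i]) lam :
  period_wall ell tau lam =
  wall ell tau (fun i => lam ord0 - 2 * lam (lift ord0 i)) (lam ord0).
Proof. by []. Qed.

(** * Four squares of equal parity with sum 4 *)

Lemma sqr_ge1 (x : int) : x != 0 -> 1 <= x ^+ 2.
Proof. by move=> x0; rewrite -gtz0_ge1 exprn_even_gt0. Qed.

Lemma sum_sqr_eq1 (c : 'I_4 -> int) : \sum_(i < 4) c i ^+ 2 = 1 ->
  exists e i0, e ^+ 2 = 1 /\ c =1 (fun i => e * ind i0 i).
Proof.
move=> c1.
have /existsP[i0 ci0] : [exists i, c i != 0].
  apply: contraPT c1; rewrite negb_exists => /forallP c0.
  by rewrite big1 // => i _; have /negPn/eqP -> := c0 i; rewrite expr0n.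
have ge1 := sqr_ge1 _ ci0.
exists (c i0), i0; split=> [|i]; rewrite ?/ind.
  move: c1; rewrite (bigD1 i0) //=.
  have : 0 <= \sum_(j < 4 | j != i0) c j ^+ 2.
    by apply: sumr_ge0 => j _; apply: sqr_ge0.
  lra.
have [->|ii0] := eqVneq; first by rewrite mulr1.
rewrite mulr0; apply/eqP/negPn/negP => /sqr_ge1 ci.
move: c1; rewrite (bigD1 i0) //= (bigD1 i) //=.
have : 0 <= \sum_(j < 4 | (j != i0) && (j != i)) c j ^+ 2.
  by apply: sumr_ge0 => j _; apply: sqr_ge0.
lra.
Qed.

(** A vector of four signs or its opposite has at most two entries equal to 1;
    the number of these entries tells the three cases apart. *)
Lemma signs4 (c : 'I_4 -> int) : (forall i, c i ^+ 2 = 1) ->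
  exists e : int, e ^+ 2 = 1 /\
    [\/ c =1 (fun=> e), exists i0, c =1 (fun i => e * (2 * ind i0 i - 1)) |
        exists i1 i2, i1 != i2 /\
          c =1 (fun i => e * (2 * (ind i1 i + ind i2 i) - 1))].
Proof.
move=> c2.
have [e [B [e2 cE Ble]]] : exists (e : int) (B : {set 'I_4}),
    [/\ e ^+ 2 = 1, forall i, c i = e * (2 * (i \in B)%:R - 1) & (#|B| <= 2)%N].
  (* [B] is the set of entries 1, or its complement with the sign [e] flipped. *)
  pose P : {set 'I_4} := [set i | c i == 1]%SET.
  have [Ple|Pgt] := leqP #|P| 2.
    exists 1, P; split=> // i; rewrite inE.
    by have := c2 i; case: eqP; lia.
  exists (-1), (~: P)%SET; split=> [//|i|].
    by rewrite !inE; have := c2 i; case: eqP => /=; nia.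
  by have := cardsC P; rewrite card_ord; lia.
have : (#|B| < 3)%N by [].
case Bn : #|B| => [|[|[|//]]] _.
- exists (- e); split; first by rewrite sqrrN.
  by apply: Or31 => i; rewrite cE (cards0_eq Bn) inE mulr0 sub0r mulrN1.
- have /cards1P[i0 BE] : #|B| == 1%N by rewrite Bn.
  by exists e; split=> //; apply: Or32; exists i0 => i; rewrite cE BE inE.
- have /cards2P[i1 [i2 [i12 BE]]] : #|B| == 2%N by rewrite Bn.
  exists e; split=> //; apply: Or33; exists i1, i2; split=> // i.
  rewrite cE BE !inE /ind; have [->|ii1] := eqVneq i i1; last by rewrite add0r.
  by rewrite (negPf i12) addr0.
Qed.

(** * Walls of classes of square -2 *)

(** The parity of [n] is that of every [c i].  For even [n] the vector [c / 2]
    has square norm 1; for odd [n] each [c i ^+ 2] is at least 1 and the four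
    add up to 4, so all of them are 1. *)
Lemma planes_of_root (R : realType) (ell : R) (tau : R[i]) (c : 'I_4 -> int)
    (n : int) (a : 'I_4 -> int) :
  \sum_(i < 4) c i ^+ 2 = 4 -> (forall i, c i = n - 2 * a i) ->
  exists k,
  [\/ wall ell tau c n = plane ell tau k,
      exists i0, wall ell tau c n = plane1 ell tau k i0,
      exists i0, wall ell tau c n = plane1' ell tau k i0 |
      exists i1 i2, i1 != i2 /\ wall ell tau c n = plane2 ell tau k i1 i2].
Proof.
move=> c4 cn.
have [h [nE|nE]] : exists h, n = 2 * h \/ n = 2 * h + 1 by exists (n %/ 2)%Z; lia.
  have cE i : c i = 2 * (h - a i) by rewrite cn nE; ring.
  have /sum_sqr_eq1[e [i0 [e1 aE]]] : \sum_(i < 4) (h - a i) ^+ 2 = 1.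
    have : 4 * (\sum_(i < 4) (h - a i) ^+ 2) = 4.
      rewrite -[RHS]c4 mulr_sumr; apply: eq_bigr => i _; rewrite cE; ring.
    lia.
  (* Since [e] is its own inverse, [2 e y = 2 h] reads [y = e h]. *)
  exists (e * h); apply: Or42; exists i0.
  rewrite plane1E -[RHS](@wall_scale _ _ _ (2 * e)); last by nia.
  congr wall; first by apply/funext => i; rewrite cE aE; ring.
  by rewrite nE -mulrA (mulrA e) -expr2 e1 mul1r.
have c1 i : c i ^+ 2 = 1.
  have cge1 j : 0 <= c j ^+ 2 - 1 by rewrite cn nE; nia.
  have : \sum_(i < 4) (c i ^+ 2 - 1) = 0.
    by rewrite sumrB c4 sumr_const card_ord.
  move/eqP; rewrite psumr_eq0 // => /allP/(_ i (mem_index_enum _))/=.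
  by rewrite subr_eq0 => /eqP.
have [e [e1 ee]] := signs4 c c1.
(* For [e = -1], [n = 2 h + 1] is [- (2 k + 1)] with [k = - h - 1]. *)
have [k kE] : exists k, n = e * (2 * k + 1).
  move/eqP: e1; rewrite sqrf_eq1 => /orP[]/eqP ->; [exists h|exists (- h - 1)];
    by rewrite nE; ring.
have e0 : e != 0 by nia.
exists k; case: ee => [cE|[i0 cE]|[i1 [i2 [i12 cE]]]].
- apply: Or41; rewrite planeE -[RHS](@wall_scale _ _ _ e) //.
  by congr wall => //; apply/funext => i; rewrite cE mulr1.
- apply: Or43; exists i0; rewrite plane1'E -[RHS](@wall_scale _ _ _ e) //.
  by congr wall => //; apply/funext => i; rewrite cE.
- apply: Or44; exists i1, i2; split=> //.
  rewrite plane2E -[RHS](@wall_scale _ _ _ e) //.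
  by congr wall => //; apply/funext => i; rewrite cE.
Qed.

(** The factor [d] restores the parity condition: a wall [(c, n)] comes from a
    class once [d c_i - d n] is even and [d c] has square norm 4.  The class has
    [d n] as its coordinate on S_0 and [a i] on the others. *)
Lemma period_wall_of_root (H : lmodType int) (dot : {symmetric H})
    (S : 'I_5 -> H) (R : realType) (ell : R) (tau : R[i])
    (d n : int) (a c : 'I_4 -> int) :
  D4_homology_basis dot S -> d != 0 ->
  \sum_(i < 4) (d * c i) ^+ 2 = 4 -> (forall i, d * c i = d * n - 2 * a i) ->
  exists2 lam, dot (Zcomb S lam) (Zcomb S lam) = - 2 &
    wall ell tau c n = period_wall ell tau lam.
Proof.
move=> hS d0 sum4 cE.
pose lam := fun j : 'I_5 => if unlift ord0 j is Some i then a i else d * n.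
have lam0 : lam ord0 = d * n by rewrite /lam unlift_none.
have lamS i : lam (lift ord0 i) = a i by rewrite /lam liftK.
exists lam.
  have := D4_norm _ _ _ lam hS; rewrite lam0.
  have -> : \sum_(i < 4) (d * n - 2 * lam (lift ord0 i)) ^+ 2 = 4.
    by rewrite -sum4; apply: eq_bigr => i _; rewrite lamS cE.
  lia.
rewrite period_wallE -[LHS](@wall_scale _ _ _ d) // lam0; congr wall.
by apply/funext => i; rewrite lamS cE.
Qed.

Theorem corollary1p17 (H : lmodType int) (dot : {symmetric H}) (S : 'I_5 -> H)
    (hS : D4_homology_basis dot S)
    (R : realType) (ell : R) (hell : 0 < ell)
    (tau : R[i]) (htau : 0 < complex.Im tau) :
  period_domain dot S ell tau =
    ~` (\bigcup_(k in [set: int])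
          (plane ell tau k
           `|` \bigcup_(i0 in [set: 'I_4]) plane1 ell tau k i0
           `|` \bigcup_(i0 in [set: 'I_4]) plane1' ell tau k i0
           `|` \bigcup_(i in [set i : 'I_4 * 'I_4 | i.1 != i.2])
                 plane2 ell tau k i.1 i.2))
  /\ (forall k : int,
        affine_plane_of_codim 3 (plane ell tau k)
        /\ (forall i0 : 'I_4, affine_plane_of_codim 3 (plane1 ell tau k i0))
        /\ (forall i0 : 'I_4, affine_plane_of_codim 3 (plane1' ell tau k i0))
        /\ (forall i1 i2 : 'I_4, i1 != i2 ->
              affine_plane_of_codim 3 (plane2 ell tau k i1 i2))).
Proof.
split.
  rewrite /period_domain; congr (~` _); apply/seteqP; split=> p.
    move=> [lam /= lam2]; rewrite period_wallE => pW.
    have sum4 := D4_norm _ _ _ lam hS; rewrite lam2 in sum4.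
    have [k] := planes_of_root _ ell tau _ _ _ sum4 (fun i => erefl).
    case=> [E|[i0 E]|[i0 E]|[i1 [i2 [i12 E]]]]; exists k => //; rewrite E in pW.
    - by left; left; left.
    - by left; left; right; exists i0.
    - by left; right; exists i0.
    - by right; exists (i1, i2).
  (* The class of each plane: the coefficients [c] of its equation are made to
     have square norm 4 by the factor 1 or 2, and then [a = d (n - c) / 2]. *)
  case=> k _ [[[|[i0 _]]|[i0 _]]|[[i1 i2] /= i12]].
  - rewrite planeE => pW.
    have [//|||lam lam2 E] := period_wall_of_root _ _ _ _ ell tau 1 (2 * k + 1)
      (fun=> k) (fun=> 1) hS.
    + by rewrite !big_ord_recr big_ord0.
    + by move=> i; ring.
    by exists lam => //; rewrite -E.
  - rewrite plane1E => pW.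
    have [//|||lam lam2 E] := period_wall_of_root _ _ _ _ ell tau 2 k
      (fun i => k - ind i0 i) (ind i0) hS.
    + by case: i0 pW => [[|[|[|[]]]]] // ? _; rewrite !big_ord_recr big_ord0.
    + by move=> i; ring.
    by exists lam => //; rewrite -E.
  - rewrite plane1'E => pW.
    have [//|||lam lam2 E] := period_wall_of_root _ _ _ _ ell tau 1 (2 * k + 1)
      (fun i => k + 1 - ind i0 i) (fun i => 2 * ind i0 i - 1) hS.
    + by case: i0 pW => [[|[|[|[]]]]] // ? _; rewrite !big_ord_recr big_ord0.
    + by move=> i; ring.
    by exists lam => //; rewrite -E.
  - rewrite plane2E => pW.
    have [//|||lam lam2 E] := period_wall_of_root _ _ _ _ ell tau 1 (2 * k + 1)
      (fun i => k + 1 - ind i1 i - ind i2 i)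
      (fun i => 2 * (ind i1 i + ind i2 i) - 1) hS.
    + case: i1 i12 pW => [[|[|[|[]]]]] // ?; case: i2 => [[|[|[|[]]]]] // ? // _ _;
      by rewrite !big_ord_recr big_ord0.
    + by move=> i; ring.
    by exists lam => //; rewrite -E.
move=> k; split; [|split; [|split]].
- by rewrite planeE; apply: (@wall_codim _ _ _ _ _ ord0).
- by move=> i0; rewrite plane1E; apply: (@wall_codim _ _ _ _ _ i0); rewrite /ind eqxx.
- by move=> i0; rewrite plane1'E; apply: (@wall_codim _ _ _ _ _ i0); rewrite /ind eqxx.
- move=> i1 i2 i12; rewrite plane2E; apply: (@wall_codim _ _ _ _ _ i1).
  by rewrite /ind eqxx (negPf i12).
Qed.
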